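(* For every odd integer $n\geq 1$, there exists a globally simple $\mathrm{N}\mathrm{H}_{n^2}(n;n)$.
   Context: Let $n,t\ge 1$ be integers with $t$ dividing $2n^2$, let $v=2n^2+t$, and let $J$ be the subgroup of $\mathbb{Z}_v$ of order $t$. A (square, tight, relative) non-zero sum Heffter array $\mathrm{N}\mathrm{H}_t(n;n)$ is an $n\times n$ array $A$ with no empty cells and with entries in $\mathbb{Z}_v$ such that: (i) the multiset $\{\pm x \mid x\in A\}$ contains each element of $\mathbb{Z}_v\setminus J$ exactly once (and no other element); (ii) the sum of the elements in every row and in every column is different from $0$ in $\mathbb{Z}_v$. An ordering $(t_1,\dots,t_k)$ of a finite list of elements of an abelian group is simple if its partial sums $s_i=\sum_{j=1}^i t_j$, $i=1,\dots,k$, are all non-zero and pairwise distinct. A natural ordering of a row (respectively column) is the ordering of its entries read cyclically from left to right (respectively from top to bottom) starting from some chosen entry. The array is globally simple if each row and each column admits at least one natural ordering that is simple. *)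

(* Defs.v *)
From mathcomp Require Import all_boot all_fingroup all_algebra.

Set Implicit Arguments.
Unset Strict Implicit.
Unset Printing Implicit Defensive.

Import GRing.Theory.
Local Open Scope ring_scope.

(* The modulus is 2n^2 + t >= 3 as soon as n, t >= 1, so that 'Z_v below is   *)
(* the ring of integers modulo v with no degenerate case.                     *)
Definition heffter_modulus (n t : nat) : nat := (2 * n ^ 2 + t)%N.

Definition entries (T : Type) (m n : nat) (A : 'M[T]_(m, n)) : seq T :=
  [seq A p.1 p.2 | p : 'I_m * 'I_n].

(* {group 'Z_v} refers to the additive group of 'Z_v. As that group is cyclic *)
(* of order v, and t divides v when it divides 2n^2, exactly one J has order  *)
(* t. In s ++ [seq - x | x <- s] each cell contributes both signs of its      *)
(* entry, hence twice the same value if x = - x.                              *)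
Definition NH (n t : nat) (A : 'M['Z_(heffter_modulus n t)]_n) : Prop :=
  [/\ exists2 J : {group 'Z_(heffter_modulus n t)},
        #|J| = t &
        perm_eq (entries A ++ [seq - x | x <- entries A]) (enum (~: J)),
      forall i : 'I_n, \sum_(j < n) A i j != 0
    & forall j : 'I_n, \sum_(i < n) A i j != 0].

Arguments NH : clear implicits.

Definition partial_sums (V : zmodType) (s : seq V) : seq V := scanl +%R 0 s.

Definition simple_ordering (V : zmodType) (s : seq V) : bool :=
  (0 \notin partial_sums s) && uniq (partial_sums s).

Definition natural_orderings (T : Type) (s : seq T) : seq (seq T) :=
  [seq rot k s | k <- iota 0 (size s)].

Definition row_seq (T : Type) (m n : nat) (A : 'M[T]_(m, n)) (i : 'I_m) :
  seq T := [seq A i j | j <- enum 'I_n].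

Definition col_seq (T : Type) (m n : nat) (A : 'M[T]_(m, n)) (j : 'I_n) :
  seq T := [seq A i j | i <- enum 'I_m].

Definition globally_simple (V : zmodType) (m n : nat) (A : 'M[V]_(m, n)) :
  Prop :=
  (forall i : 'I_m, has (@simple_ordering V) (natural_orderings (row_seq A i)))
  /\
  (forall j : 'I_n, has (@simple_ordering V) (natural_orderings (col_seq A j))).

(* Main.v *)
Require Import Defs.
From mathcomp Require Import all_boot all_fingroup all_algebra.
From mathcomp Require Import zify.

(** Since [v = 3 n^2] and [J] consists of the multiples of 3, the entries must
    be, up to sign, the [n^2] integers [b_0 < b_1 < ...] that are not multiples
    of 3 and lie strictly between [0] and [v / 2]. Fill the array with them
    in reading order, with checkerboard signs. Along any row or column the
    absolute values increase and the signs alternate, so the partial sums of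
    odd and of even rank have opposite signs, and those of equal parity have
    strictly increasing absolute values; all are below [v / 2] in absolute
    value, hence they are distinct and non-zero modulo [v]. *)

Set Implicit Arguments.
Unset Strict Implicit.
Unset Printing Implicit Defensive.

Import GRing.Theory.
Local Open Scope ring_scope.

(** * Simple orderings of sequences given by a formula *)

Lemma partial_sums_mkseq (V : zmodType) (g : nat -> V) (n : nat) :
  partial_sums (mkseq g n) = mkseq (fun m => \sum_(i < m.+1) g i) n.
Proof.
elim: n => [//|n IHn]; rewrite !mkseqS /partial_sums scanl_rcons.
rewrite -/(partial_sums _) IHn -mkseqS (foldl_idx (idx := 0)) big_map.
by rewrite -(big_mkord xpredT g) /index_iota subn0.
Qed.

(** Prepending the empty sum 0 to the partial sums merges the two conditions of simplicity into a
    single injectivity statement, now over [n.+1] indices. *)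
Lemma simple_ordering_mkseq (V : zmodType) (g : nat -> V) (n : nat) :
  simple_ordering (mkseq g n) = uniq (mkseq (fun m => \sum_(i < m) g i) n.+1).
Proof.
rewrite /simple_ordering partial_sums_mkseq -cons_uniq; congr uniq.
by rewrite /mkseq /= big_ord0 -[1%N]addn0 iotaDl -map_comp.
Qed.

Lemma has_natural_ordering (T : Type) (P : pred (seq T)) (s : seq T) :
  (0 < size s)%N -> P s -> has P (natural_orderings s).
Proof.
by rewrite /natural_orderings; case: (size s) => //= k _; rewrite rot0 => ->.
Qed.

Lemma map_enum_ord (T : Type) (g : nat -> T) (n : nat) :
  [seq g (val i) | i <- enum 'I_n] = mkseq g n.
Proof. by rewrite /mkseq -val_enum_ord -map_comp. Qed.

(** * Alternating sums of increasing integers modulo [v] *)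

Section SignedResidues.

Variables (v : nat) (v_gt1 : (1 < v)%N).

Lemma natr_Zp_inj (a b : nat) :
  (a < v)%N -> (b < v)%N -> a%:R = b%:R :> 'Z_v -> a = b.
Proof.
by move=> av bv /(congr1 val); rewrite /= !val_Zp_nat // !modn_small.
Qed.

(** With opposite signs, [a + b] would vanish modulo [v] while being less than [v], which forces
    both to be 0. *)
Lemma sign_natr_inj (p q a b : nat) : (2 * a < v)%N -> (2 * b < v)%N ->
  (-1) ^+ p * a%:R = (-1) ^+ q * b%:R :> 'Z_v ->
  a = b /\ (a = 0%N \/ odd p = odd q).
Proof.
move=> av bv; rewrite -signr_odd -[(-1) ^+ q]signr_odd !mulr_sign.
have opp_case (c d : nat) : (2 * c < v)%N -> (2 * d < v)%N ->
    - c%:R = d%:R :> 'Z_v -> c = d /\ c = 0%N.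
  move=> cv dv /eqP; rewrite eq_sym -addr_eq0 -natrD => /eqP E.
  by have := @natr_Zp_inj (d + c) 0 ltac:(lia) ltac:(lia) E; lia.
case: (odd p) (odd q) => [] [].
- by move/oppr_inj/natr_Zp_inj => ->; try lia; split => //; right.
- by case/opp_case => // -> ->; split => //; left.
- by move/esym/opp_case => [] // -> ->; split => //; left.
- by move/natr_Zp_inj => ->; try lia; split => //; right.
Qed.

(** This is [a (m-1) - a (m-2) + ...], the absolute value of the alternating sum of [m] terms. The
    truncated subtraction is exact by [alt_abs_bounds]. *)
Fixpoint alt_abs (a : nat -> nat) (m : nat) : nat :=
  if m is k.+1 then (a k - alt_abs a k)%N else 0%N.

Variables (n : nat) (a : nat -> nat).
Hypotheses (a0_gt0 : (0 < a 0)%N)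
  (a_incr : forall i, (i.+1 < n)%N -> (a i < a i.+1)%N)
  (a_small : forall i, (i < n)%N -> (2 * a i < v)%N).

(** The two bounds feed each other: subtracting from [a m] leaves at most [a m], which is less than
    the next term. *)
Lemma alt_abs_bounds (m : nat) : (m < n)%N ->
  (alt_abs a m < a m)%N /\ (alt_abs a m.+1 <= a m)%N.
Proof.
elim: m => [|m IHm] mn /=; first by lia.
by have := IHm (ltnW mn); have := a_incr mn; rewrite /=; lia.
Qed.

Lemma alt_abs_small (m : nat) : (m <= n)%N -> (2 * alt_abs a m < v)%N.
Proof.
case: m => [|m] mn; first by rewrite /=; lia.
by have := alt_abs_bounds mn; have := a_small mn; lia.
Qed.

Lemma alt_abs_gt0 (m : nat) : (0 < m <= n)%N -> (0 < alt_abs a m)%N.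
Proof.
by case: m => //= m mn; have := alt_abs_bounds mn; lia.
Qed.

(** Two steps of the recursion add the positive gap [a l.+1 - a l]. *)
Lemma alt_abs_incr (m k : nat) :
  (m + 2 * k.+1 <= n)%N -> (alt_abs a m < alt_abs a (m + 2 * k.+1))%N.
Proof.
have step l : (l.+2 <= n)%N -> (alt_abs a l < alt_abs a l.+2)%N.
  move=> ln; have := alt_abs_bounds (ltnW ln); have := a_incr ln.
  by rewrite /=; lia.
elim: k => [|k IHk] kn; first by rewrite muln1 addn2; apply: step; lia.
have E : (m + 2 * k.+2 = (m + 2 * k.+1).+2)%N by lia.
rewrite E; apply: ltn_trans (IHk _) (step _ _); lia.
Qed.

(** The sum takes the sign of its last term, of rank [m - 1]; the exponent [(e + m).+1] has the same
    parity and avoids a predecessor. *)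
Lemma alternating_sumE (e m : nat) : (m <= n)%N ->
  \sum_(i < m) (-1) ^+ (e + i) * (a i)%:R =
    (-1) ^+ (e + m).+1 * (alt_abs a m)%:R :> 'Z_v.
Proof.
elim: m => [|m IHm] mn; first by rewrite big_ord0 mulr0.
have [cm _] := alt_abs_bounds mn.
rewrite big_ord_recr /= IHm 1?ltnW // natrB 1?ltnW // addnS !exprS.
by rewrite !mulN1r opprK mulNr mulrBr addrC.
Qed.

Lemma alternating_sum_inj (e : nat) :
  {in gtn n.+1 &, injective
    (fun m : nat => \sum_(i < m) (-1) ^+ (e + i) * (a i)%:R : 'Z_v)}.
Proof.
have lt_neq l m : (l < m <= n)%N ->
    \sum_(i < l) (-1) ^+ (e + i) * (a i)%:R
      <> \sum_(i < m) (-1) ^+ (e + i) * (a i)%:R :> 'Z_v.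
  move=> lmn; rewrite !alternating_sumE; try lia.
  case/sign_natr_inj; try by apply: alt_abs_small; lia.
  move=> E par; have := @alt_abs_gt0 m ltac:(lia); case: par => [|par]; first lia.
  (* Equal signs make [m - l] even, and it is positive, hence of the form [2 * k.+1] for this
     [k]. *)
  have := @alt_abs_incr l ((m - l)./2.-1).
  have -> : (l + 2 * ((m - l)./2.-1).+1 = m)%N by lia.
  by lia.
move=> l m; rewrite !inE => ln mn E; case: (ltngtP l m) => // lm.
- by case: (@lt_neq l m ltac:(lia)).
- by case: (@lt_neq m l ltac:(lia)).
Qed.

Lemma alternating_simple (e : nat) :
  simple_ordering (mkseq (fun i => (-1) ^+ (e + i) * (a i)%:R : 'Z_v) n).
Proof.
rewrite simple_ordering_mkseq; apply/mkseq_uniqP; exact: alternating_sum_inj.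
Qed.

Lemma alternating_sum_neq0 (e : nat) : (0 < n)%N ->
  \sum_(i < n) (-1) ^+ (e + i) * (a i)%:R != 0 :> 'Z_v.
Proof.
move=> n_gt0; apply/eqP => E.
(* The full sum is compared with the empty one. *)
have := @alternating_sum_inj e n 0%N; rewrite !inE big_ord0 => H.
by move: (H ltac:(lia) ltac:(lia) E); lia.
Qed.

End SignedResidues.

(* Enumerates [1, 2, 4, 5, 7, 8, ...] from index 0. *)
Definition nonmultiple3 (k : nat) : nat := (k + k./2).+1.

(** * The checkerboard array and its set of signed entries *)

Section Construction.

Variables (n : nat) (n_gt0 : (0 < n)%N).

Local Notation v := (heffter_modulus n (n ^ 2)).

Lemma heffter_modulusE : v = (3 * n ^ 2)%N.
Proof. by rewrite /heffter_modulus; lia. Qed.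

Lemma heffter_modulus_gt1 : (1 < v)%N.
Proof. by rewrite heffter_modulusE; nia. Qed.

Let v_gt1 := heffter_modulus_gt1.

Definition checkerboard : 'M['Z_v]_n :=
  \matrix_(i, j) ((-1) ^+ (i + j) * (nonmultiple3 (i * n + j))%:R).

Lemma cell_lt (i j : nat) : (i < n)%N -> (j < n)%N -> (i * n + j < n ^ 2)%N.
Proof. by rewrite -mulnn; nia. Qed.

(** The doubled value is at most [3 * k + 2], hence at most [3 * n ^ 2 - 1]. *)
Lemma nonmultiple3_small (k : nat) :
  (k < n ^ 2)%N -> (2 * nonmultiple3 k < v)%N.
Proof. by rewrite heffter_modulusE /nonmultiple3; lia. Qed.

Lemma cell_inj (p q : 'I_n * 'I_n) :
  (p.1 * n + p.2 = q.1 * n + q.2)%N -> p = q.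
Proof.
case: p q => [i j] [k l] /= E.
have [Ei Ej] : i = k :> nat /\ j = l :> nat.
  have := congr1 (divn^~ n) E; have := congr1 (modn^~ n) E.
  by rewrite /= !modnMDl !divnMDl // !modn_small // !divn_small // !addn0.
by congr pair; apply: val_inj.
Qed.

Lemma val_Zp_opp (x : 'Z_v) : val (- x) = ((v - x) %% v)%N.
Proof. by rewrite /=; move: (nat_of_ord x) => m; rewrite Zp_cast. Qed.

Definition mult3 : {set 'Z_v} := [set x : 'Z_v | (3 %| x)%N].

(** As 3 divides [v], divisibility by 3 can be tested on any representative. *)
Lemma dvd3_mod (m : nat) : (3 %| m %% v)%N = (3 %| m)%N.
Proof. by rewrite /dvdn modn_dvdm // heffter_modulusE dvdn_mulr. Qed.

Lemma group_set_mult3 : group_set mult3.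
Proof.
apply/group_setP; split; first by rewrite inE.
move=> x y; rewrite !inE => x3 y3.
have -> : nat_of_ord (x * y)%g = ((x + y) %% v)%N.
  by rewrite /=; move: (x + y)%N => m; rewrite Zp_cast.
by rewrite dvd3_mod dvdn_add.
Qed.

Canonical mult3_group : {group 'Z_v} := Group group_set_mult3.

Lemma opp_mult3 (x : 'Z_v) : (- x \in mult3) = (x \in mult3).
Proof.
have xv : (x < v)%N by rewrite -[X in (_ < X)%N](Zp_cast v_gt1) ltn_ord.
rewrite !inE -[nat_of_ord (- x)]/(val (- x)) val_Zp_opp dvd3_mod.
by rewrite dvdn_subr ?(ltnW xv) // heffter_modulusE dvdn_mulr.
Qed.

Lemma checkerboard_notin_mult3 (i j : 'I_n) : checkerboard i j \notin mult3.
Proof.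
rewrite mxE -signr_odd mulr_sign.
suff H : (nonmultiple3 (i * n + j))%:R \notin mult3.
  by case: ifP; rewrite ?opp_mult3.
by rewrite inE val_Zp_nat // dvd3_mod /nonmultiple3; lia.
Qed.

Lemma signed_entries_oppr (x : 'Z_v) :
  - x \in entries checkerboard ++ [seq - y | y <- entries checkerboard] ->
  x \in entries checkerboard ++ [seq - y | y <- entries checkerboard].
Proof.
rewrite !mem_cat => /orP [H|/mapP [y yA /oppr_inj ->]]; last by rewrite yA.
by rewrite -[x]opprK (map_f (fun y => - y) H) orbT.
Qed.

Lemma small_signed_entry (x : nat) : (2 * x < v)%N -> ~~ (3 %| x)%N ->
  x%:R \in entries checkerboard ++ [seq - y | y <- entries checkerboard].
Proof.
(* The rank of [x]: the number of non-multiples of 3 among the positive integers below [x]. *)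
move=> xv x3; pose k := (x - 1 - x %/ 3)%N.
have kn : (k < n ^ 2)%N by move: xv; rewrite heffter_modulusE /k; lia.
have -> : x = nonmultiple3 k by rewrite /nonmultiple3 /k; lia.
have in_ : (k %/ n < n)%N by rewrite ltn_divLR // mulnn.
have jn : (k %% n < n)%N by rewrite ltn_mod.
have := codom_f (fun p : 'I_n * 'I_n => checkerboard p.1 p.2)
                (Ordinal in_, Ordinal jn).
rewrite -/(entries _) /= mxE /= -divn_eq -signr_odd mulr_sign.
case: ifP => _ H; last by rewrite mem_cat H.
by apply: signed_entries_oppr; rewrite mem_cat H.
Qed.

Lemma mem_signed_entries :
  entries checkerboard ++ [seq - x | x <- entries checkerboard]
    =i enum (~: mult3).
Proof.
move=> x; rewrite mem_enum in_setC; apply/idP/idP.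
  rewrite mem_cat => /orP [/mapP [[i j] _ ->]|/mapP [y /mapP [[i j] _ ->] ->]];
  by rewrite ?opp_mult3 checkerboard_notin_mult3.
have xv : (x < v)%N by rewrite -[X in (_ < X)%N](Zp_cast v_gt1) ltn_ord.
(* Either [x] or [v - x] lies below [v / 2]; equality would make 3 divide [2 * x], hence [x]. *)
rewrite inE => x3; case: (ltngtP (2 * x) v) => x2v.
- by rewrite -[x]natr_Zp; apply: small_signed_entry.
- apply: signed_entries_oppr; rewrite -[- x]natr_Zp.
  have -> : nat_of_ord (- x) = (v - x)%N.
    by rewrite -[LHS]/(val (- x)) val_Zp_opp modn_small; lia.
  apply: small_signed_entry; first lia.
  by have := heffter_modulusE; lia.
- by have := heffter_modulusE; lia.
Qed.

(** The extra signs treat at once a repeated entry ([e = f = 0]) and an entry opposite to another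
    ([e = 1], [f = 0]). *)
Lemma checkerboard_entry_inj (e f : nat) (p q : 'I_n * 'I_n) :
  (-1) ^+ e * checkerboard p.1 p.2 = (-1) ^+ f * checkerboard q.1 q.2 ->
  p = q /\ odd e = odd f.
Proof.
rewrite !mxE !mulrA -!exprD.
case/(sign_natr_inj v_gt1); try by apply/nonmultiple3_small/cell_lt.
rewrite {1 2}/nonmultiple3 => E par.
have pq : p = q by apply: cell_inj; lia.
by split=> //; move: par; rewrite pq; case=> [//|]; rewrite !oddD; lia.
Qed.

Lemma uniq_signed_entries :
  uniq (entries checkerboard ++ [seq - x | x <- entries checkerboard]).
Proof.
have entries_uniq : uniq (entries checkerboard).
  rewrite map_inj_uniq ?enum_uniq // => p q E.
  by have [] := @checkerboard_entry_inj 0 0 p q ltac:(by rewrite E).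
rewrite cat_uniq entries_uniq (map_inj_uniq oppr_inj) entries_uniq andbT /=.
apply/hasPn => _ /mapP [_ /mapP [p _ ->] ->]; apply/mapP => [[q _ E]].
have [|_ //] := @checkerboard_entry_inj 1 0 p q.
by rewrite expr1 expr0 mulN1r mul1r.
Qed.

Lemma perm_signed_entries :
  perm_eq (entries checkerboard ++ [seq - x | x <- entries checkerboard])
          (enum (~: mult3)).
Proof.
exact: uniq_perm uniq_signed_entries (enum_uniq _) mem_signed_entries.
Qed.

(** The complement is listed without repetition by the [2 * n ^ 2] signed entries, leaving [n ^ 2]
    of the [3 * n ^ 2] residues. *)
Lemma card_mult3 : #|mult3| = (n ^ 2)%N.
Proof.
have := perm_size perm_signed_entries.
rewrite size_cat !size_map -enumT -!cardE card_prod card_ord => cardC.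
have : (#|mult3| + #|~: mult3| = v)%N by rewrite cardsC card_ord Zp_cast.
rewrite -cardC => cardD; apply: (@addIn (n * n + n * n)%N).
by rewrite cardD heffter_modulusE -mulnn; lia.
Qed.

(** * Rows and columns as alternating sequences *)

Let row_abs (i k : nat) := nonmultiple3 (i * n + k).
Let col_abs (j k : nat) := nonmultiple3 (k * n + j).

Lemma row_abs_incr (i k : nat) : (row_abs i k < row_abs i k.+1)%N.
Proof. by rewrite /row_abs /nonmultiple3; lia. Qed.

Lemma col_abs_incr (j k : nat) : (col_abs j k < col_abs j k.+1)%N.
Proof. by rewrite /col_abs /nonmultiple3 mulSn; lia. Qed.

Lemma row_abs_small (i : 'I_n) (k : nat) :
  (k < n)%N -> (2 * row_abs i k < v)%N.
Proof. by move=> kn; apply/nonmultiple3_small/cell_lt. Qed.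

Lemma col_abs_small (j : 'I_n) (k : nat) :
  (k < n)%N -> (2 * col_abs j k < v)%N.
Proof. by move=> kn; apply/nonmultiple3_small/cell_lt. Qed.

Lemma row_seq_checkerboard (i : 'I_n) : row_seq checkerboard i =
  mkseq (fun k => (-1) ^+ (i + k) * (row_abs i k)%:R) n.
Proof. by rewrite -map_enum_ord; apply: eq_map => j; rewrite mxE. Qed.

Lemma col_seq_checkerboard (j : 'I_n) : col_seq checkerboard j =
  mkseq (fun k => (-1) ^+ (j + k) * (col_abs j k)%:R) n.
Proof. by rewrite -map_enum_ord; apply: eq_map => i; rewrite mxE addnC. Qed.

Lemma NH_checkerboard : NH n (n ^ 2)%N checkerboard.
Proof.
split.
- by exists mult3_group; [exact: card_mult3 | exact: perm_signed_entries].
- move=> i; under eq_bigr do rewrite mxE.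
  by apply: (alternating_sum_neq0 v_gt1 (a := row_abs i));
    auto using row_abs_incr, row_abs_small.
- move=> j; under eq_bigr do rewrite mxE addnC.
  by apply: (alternating_sum_neq0 v_gt1 (a := col_abs j));
    auto using col_abs_incr, col_abs_small.
Qed.

Lemma globally_simple_checkerboard : globally_simple checkerboard.
Proof.
split=> [i|j].
- rewrite row_seq_checkerboard; apply: has_natural_ordering.
    by rewrite size_mkseq.
  by apply: (alternating_simple v_gt1); auto using row_abs_incr, row_abs_small.
- rewrite col_seq_checkerboard; apply: has_natural_ordering.
    by rewrite size_mkseq.
  by apply: (alternating_simple v_gt1); auto using col_abs_incr, col_abs_small.
Qed.

End Construction.

Theorem proposition3p8 (n : nat) (hn : (1 <= n)%N) (hodd : odd n) :
  exists A : 'M['Z_(heffter_modulus n (n ^ 2))]_n,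
    NH n (n ^ 2)%N A /\ globally_simple A.
Proof.
exists (checkerboard n).
by split; [apply: NH_checkerboard | apply: globally_simple_checkerboard].
Qed.
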